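(* Let $\Sigma=\{a,b\}$, let $L=\Sigma^+$, and let $h:\Sigma^*\to M_{36}$ be the morphism onto the finite monoid $M_{36}$ defined in the context. Then: $(L,h)$ is unit-separated; $L$ is $h$-substitutable; the set of relative primes of $(L,h)$ has exactly fifteen elements; there are thirty-five live non-unit relative classes, and every one of them has a unique exact factorization into relative primes.
   Context: The monoid. Let $Q_0=\{0,1,2,3\}$. A transformation $f:Q_0\to Q_0$ is written as the tuple $(f(0),f(1),f(2),f(3))$, and products of transformations are composed from left to right: $(fg)(x)=g(f(x))$. Put $\tau_a=(1,2,0,0)$, $\tau_b=(1,3,1,0)$, and let $M_0$ be the submonoid (containing the identity) of the full transformation monoid on $Q_0$ generated by $\tau_a,\tau_b$. Let $h_0:\{a,b\}^*\to M_0$ be the morphism with $h_0(a)=\tau_a$, $h_0(b)=\tau_b$. Let $\sim_0$ be the least monoid congruence on $M_0$ with $h_0(ab)\sim_0 h_0(abaaab)$, let $M_{36}=M_0/{\sim_0}$, let $\pi_0:M_0\to M_{36}$ be the projection, and $h=\pi_0\circ h_0$. General definitions, for $L\subseteq\Sigma^*$ and a monoid morphism $h:\Sigma^*\to M$ into a finite monoid. $D_L(x)=\{(u,v)\in\Sigma^*\times\Sigma^*:uxv\in L\}$; $x\equiv_L y$ iff $D_L(x)=D_L(y)$. The relative syntactic congruence $\theta=\theta_{L,h}$ is: $x\,\theta\,y$ iff $x\equiv_L y$ and $h(x)=h(y)$. Its classes $[x]$ are called relative classes. A relative class is live if $D_L(x)\neq\varnothing$ for its members $x$. The unit class is $[\varepsilon]$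 ($\varepsilon$ the empty word); non-unit means different from $[\varepsilon]$. $(L,h)$ is unit-separated if $[\varepsilon]=\{\varepsilon\}$. $L$ is $h$-substitutable if for all $x,y\in\Sigma^*$, $h(x)=h(y)$ and $D_L(x)\cap D_L(y)\ne\varnothing$ imply $x\equiv_L y$. For sets of words, $X\cdot Y=\{xy:x\in X,y\in Y\}$. A relative prime is a live non-unit relative class $P$ such that whenever $P=X\cdot Y$ (equality of sets) for relative classes $X,Y$, one of $X,Y$ is $[\varepsilon]$. An exact factorization of a relative class $X$ into relative primes is a finite nonempty sequence $(P_1,\dots,P_k)$ of relative primes with $X=P_1\cdot\ldots\cdot P_k$ as sets of words; uniqueness means uniqueness of the sequence. *)

(* Defs.v *)
From HB Require Import structures.
From mathcomp Require Import all_boot.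
From mathcomp Require Import boolp classical_sets cardinality.

Set Implicit Arguments.
Unset Strict Implicit.
Unset Printing Implicit Defensive.

Local Open Scope classical_set_scope.
Local Open Scope quotient_scope.

Section RelativeClasses.
Context {Sigma M : Type} (L : set (seq Sigma)) (h : seq Sigma -> M).

Definition contexts (x : seq Sigma) : set (seq Sigma * seq Sigma) :=
  [set c | L (c.1 ++ x ++ c.2)].

Definition syn_equiv (x y : seq Sigma) : Prop := contexts x = contexts y.

Definition theta (x y : seq Sigma) : Prop := syn_equiv x y /\ h x = h y.

Definition rel_class_of (x : seq Sigma) : set (seq Sigma) := [set y | theta x y].

Definition rel_class (X : set (seq Sigma)) : Prop :=
  exists x, X = rel_class_of x.

Definition unit_class : set (seq Sigma) := rel_class_of [::].

Definition live (X : set (seq Sigma)) : Prop :=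
  forall x, X x -> contexts x !=set0.

Definition live_nonunit_class (X : set (seq Sigma)) : Prop :=
  [/\ rel_class X, live X & X <> unit_class].

Definition unit_separated : Prop := unit_class = [set [::]].

Definition substitutable : Prop :=
  forall x y, h x = h y -> contexts x `&` contexts y !=set0 -> syn_equiv x y.

Definition lang_mul (X Y : set (seq Sigma)) : set (seq Sigma) :=
  [set x ++ y | x in X & y in Y].

Definition rel_prime (P : set (seq Sigma)) : Prop :=
  live_nonunit_class P /\
  forall X Y, rel_class X -> rel_class Y -> P = lang_mul X Y ->
    X = unit_class \/ Y = unit_class.

Definition exact_factorization
    (X : set (seq Sigma)) (Ps : seq (set (seq Sigma))) : Prop :=
  [/\ Ps <> [::], {in Ps, forall P, rel_prime P} &
      X = foldr lang_mul [set [::]] Ps].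

End RelativeClasses.

Definition submonoid_gen (M : monoidType) (A : {pred M}) : {pred M} :=
  fun x => `[< forall S : {pred M},
    monoid_closed S -> {subset A <= S} -> x \in S >].

Section Congruences.
Context {M : monoidType}.
Local Open Scope group_scope.

Definition monoid_congruence (R : rel M) : Prop :=
  equivalence_rel R /\
  forall x x' y y', R x x' -> R y y' -> R (x * y) (x' * y').

Definition least_congruence (u v : M) : rel M := fun x y =>
  `[< forall R : rel M, monoid_congruence R -> R u v -> R x y >].

End Congruences.

Lemma submonoid_gen_closed (M : monoidType) (A : {pred M}) :
  monoid_closed (submonoid_gen A).
Proof.
split=> [|x y /asboolP Ax /asboolP Ay]; apply/asboolP => S SM AS.
  by case: SM.
by case: (SM) => _; apply; [apply: Ax | apply: Ay].
Qed.

Lemma sub_submonoid_gen (M : monoidType) (A : {pred M}) :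
  {subset A <= submonoid_gen A}.
Proof. by move=> x Ax; apply/asboolP => S _; apply. Qed.

Lemma least_congruenceP (M : monoidType) (u v : M) :
  monoid_congruence (least_congruence u v).
Proof.
split=> [x y z|x x' y y' /asboolP xx /asboolP yy].
  split; first by apply/asboolP => R [eR _] _; case: (eR z z z).
  move=> /asboolP xy; apply/asboolP/asboolP => H R cR uv;
    have := H R cR uv; have := xy R cR uv; case: cR => eR _;
    by case: (eR x y z) => _ /[apply] ->.
apply/asboolP => R cR uv; case: (cR) => _; apply; [exact: xx | exact: yy].
Qed.

(* A wrapper for {ffun 'I_4 -> 'I_4}, whose library product is pointwise. *)
Definition transf := {ffun 'I_4 -> 'I_4}.
HB.instance Definition _ := Finite.on transf.

Definition transf_one : transf := [ffun x => x].
Definition transf_mul (f g : transf) : transf := [ffun x => g (f x)].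

Fact transf_mulA : associative transf_mul.
Proof. by move=> f g k; apply/ffunP => x; rewrite !ffunE. Qed.
Fact transf_mul1 : left_id transf_one transf_mul.
Proof. by move=> f; apply/ffunP => x; rewrite !ffunE. Qed.
Fact transf_mulr1 : right_id transf_one transf_mul.
Proof. by move=> f; apply/ffunP => x; rewrite !ffunE. Qed.
HB.instance Definition _ :=
  isMonoid.Build transf transf_mulA transf_mul1 transf_mulr1.

Definition transf_of (i j k l : nat) : transf :=
  [ffun x : 'I_4 => inord (nth 0 [:: i; j; k; l] x)].

Definition tau_a : transf := transf_of 1 2 0 0.
Definition tau_b : transf := transf_of 1 3 1 0.

Definition in_M0 : {pred transf} := submonoid_gen (pred2 tau_a tau_b).

Definition M0 : Type := {f : transf | in_M0 f}.
HB.instance Definition _ := SubFinite.on M0.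
HB.instance Definition _ := SubChoice_isSubMonoid.Build transf in_M0 M0
  (submonoid_gen_closed (pred2 tau_a tau_b)).

Variant letter := La | Lb.

Definition tau (c : letter) : transf := if c is La then tau_a else tau_b.

Fact tau_in_M0 (c : letter) : in_M0 (tau c).
Proof. by apply: sub_submonoid_gen; case: c; rewrite !inE eqxx ?orbT. Qed.

Definition h0 (w : seq letter) : M0 :=
  (\prod_(c <- w) (exist _ (tau c) (tau_in_M0 c) : M0))%g.

Definition sim0 : rel M0 :=
  least_congruence (h0 [:: La; Lb]) (h0 [:: La; Lb; La; La; La; Lb]).

Fact sim0_congruence : monoid_congruence sim0.
Proof. exact: least_congruenceP. Qed.

Fact sim0_refl : reflexive sim0.
Proof. by move=> x; have [e _] := sim0_congruence; have [] := e x x x. Qed.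

Fact sim0_left_trans : left_transitive sim0.
Proof. by move=> x y xy z; have [e _] := sim0_congruence; have [_ ->] := e x y z. Qed.

Fact sim0_sym : symmetric sim0.
Proof.
have sym x y : sim0 x y -> sim0 y x.
  by move=> xy; rewrite -(sim0_left_trans xy) sim0_refl.
by move=> x y; apply/idP/idP; apply: sym.
Qed.

Fact sim0_trans : transitive sim0.
Proof. by move=> y x z /sim0_left_trans ->. Qed.

Canonical sim0_equiv := EquivRel sim0 sim0_refl sim0_sym sim0_trans.

Definition M36 : Type := {eq_quot sim0_equiv}.
HB.instance Definition _ := EqQuotient.on M36.
Fact M36_reprK : cancel (repr : M36 -> M0) \pi_M36.
Proof. exact: reprK. Qed.
HB.instance Definition _ : isCountable M36 := CanIsCountable M36_reprK.
HB.instance Definition _ : isFinite M36 :=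
  isFinite.Build M36 (pcan_enumP (can_pcan M36_reprK)).

Definition pi0 (x : M0) : M36 := \pi_M36 x.

Section M36Monoid.
Local Open Scope group_scope.

Definition M36_one : M36 := pi0 1.
Definition M36_mul (X Y : M36) : M36 := pi0 (repr X * repr Y).

Lemma pi0_mul (x y : M0) : pi0 (x * y) = M36_mul (pi0 x) (pi0 y).
Proof.
apply/eqmodP; have [_ cong] := sim0_congruence.
by apply: cong; rewrite sim0_sym; apply/eqmodP; rewrite reprK.
Qed.

Lemma pi0_surj (X : M36) : exists x, X = pi0 x.
Proof. by exists (repr X); rewrite /pi0 reprK. Qed.

Fact M36_mulA : associative M36_mul.
Proof.
move=> X Y Z; have [x ->] := pi0_surj X; have [y ->] := pi0_surj Y.
by have [z ->] := pi0_surj Z; rewrite -!pi0_mul mulgA.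
Qed.

Fact M36_mul1 : left_id M36_one M36_mul.
Proof. by move=> X; have [x ->] := pi0_surj X; rewrite -pi0_mul mul1g. Qed.

Fact M36_mulr1 : right_id M36_one M36_mul.
Proof. by move=> X; have [x ->] := pi0_surj X; rewrite -pi0_mul mulg1. Qed.

HB.instance Definition _ := isMonoid.Build M36 M36_mulA M36_mul1 M36_mulr1.

End M36Monoid.

Definition h (w : seq letter) : M36 := pi0 (h0 w).

Lemma h_nil : h [::] = 1%g.
Proof. by rewrite /h /h0 big_nil. Qed.

Lemma h_cat (u v : seq letter) : h (u ++ v) = (h u * h v)%g.
Proof. by rewrite /h /h0 big_cat pi0_mul. Qed.

Lemma h0_surj (x : M0) : exists w, x = h0 w.
Proof.
pose S : {pred transf} := fun f => `[< exists w, f = val (h0 w) >].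
suff /asboolP[w xw] : val x \in S by exists w; apply: val_inj.
have /asboolP := valP x; apply.
  split=> [|f g /asboolP[u ->] /asboolP[v ->]]; apply/asboolP.
    by exists [::]; rewrite /h0 big_nil.
  by exists (u ++ v); rewrite /h0 big_cat.
move=> f; rewrite inE => /orP[] /eqP ->; apply/asboolP.
  by exists [:: La]; rewrite /h0 big_seq1.
by exists [:: Lb]; rewrite /h0 big_seq1.
Qed.

Lemma h_surj (X : M36) : exists w, X = h w.
Proof. by have [x ->] := pi0_surj X; have [w ->] := h0_surj x; exists w. Qed.

Definition nonempty_words : set (seq letter) := [set w | w <> [::]].

(* Main.v *)
Require Import Defs.
From mathcomp Require Import all_boot.
From mathcomp Require Import boolp classical_sets cardinality.

(** Apart from [{ε}], the relative classes are the fibres of [h] over the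
    non-identity elements of [M36], because every context accepts a nonempty
    word.  If a single edge [x -> m], labelled [c], of the right (or left) Cayley
    graph of [M36] leads to [m], then the class of [m] is exactly the product of
    the classes of [x] and [c] (or of [c] and [x]); such splittings decompose
    every class into the fifteen primes.  Conversely, an exact factorization of
    a class induces a factorization of each of its words, and one to three
    well-chosen words per class leave only one common factorization. *)

Set Implicit Arguments.
Unset Strict Implicit.
Unset Printing Implicit Defensive.

Local Open Scope classical_set_scope.
Local Open Scope card_scope.

Local Notation a := La.
Local Notation b := Lb.
Local Notation word := (seq letter).

(** * The words up to [h] *)

(** Bare naturals instead of ordinals and finite functions, so that [vm_compute] can evaluate
    words. *)
Definition act (x : nat) (c : letter) : nat :=
  nth 0 (if c is La then [:: 1; 2; 0; 0] else [:: 1; 3; 1; 0]) x.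

Definition transf_word (w : word) : seq nat :=
  [seq foldl act x w | x <- iota 0 4].

Lemma tauE c (x : 'I_4) : tau c x = act x c :> nat.
Proof.
by case: c; rewrite /tau /tau_a /tau_b /transf_of ffunE inordK //;
  case: x => [[|[|[|[|x]]]]].
Qed.

Lemma h0_cons c w : h0 (c :: w) = (h0 [:: c] * h0 w)%g.
Proof. by rewrite /h0 big_cons big_seq1. Qed.

Lemma h0_cat u v : h0 (u ++ v) = (h0 u * h0 v)%g.
Proof. by rewrite /h0 big_cat. Qed.

Lemma h0E w (x : 'I_4) : val (h0 w) x = foldl act x w :> nat.
Proof.
elim: w x => [|c w IHw] x.
  by rewrite /h0 big_nil -[LHS]/(nat_of_ord (transf_one x)) ffunE.
by rewrite h0_cons valM ffunE IHw /h0 big_seq1 tauE.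
Qed.

Lemma h0_eqP u v : reflect (h0 u = h0 v) (transf_word u == transf_word v).
Proof.
apply: (iffP eqP) => [/eq_in_map uv | uv].
  apply: val_inj; apply/ffunP => x; apply: val_inj; rewrite /= !h0E.
  by apply: uv; rewrite mem_iota /= ltn_ord.
apply/eq_in_map => x; rewrite mem_iota => /= x4.
by rewrite -[x]/(nat_of_ord (Ordinal x4)) -!h0E uv.
Qed.

(* The right Cayley graph of M36, whose elements are numbered in the order of
   [normal_forms]: entry i lists the targets of the a-edge and the b-edge. *)
Definition cayley : seq (nat * nat) :=
  [:: (1, 2); (3, 4); (5, 6); (7, 8); (9, 10); (11, 12); (11, 13); (1, 14);
     (15, 16); (17, 18); (17, 17); (19, 14); (20, 21); (19, 2); (22, 23);
     (24, 18); (24, 24); (25, 4); (18, 18); (5, 26); (27, 18); (27, 27);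
     (28, 18); (28, 28); (29, 8); (9, 4); (30, 31); (32, 12); (33, 14);
     (15, 8); (34, 18); (34, 34); (20, 12); (22, 14); (35, 26); (30, 26)].

(** The shortlex-least word leading from state 0 to each state. *)
Definition normal_forms : seq word :=
  [:: [::]; [:: a]; [:: b]; [:: a; a]; [:: a; b]; [:: b; a]; [:: b; b];
     [:: a; a; a]; [:: a; a; b]; [:: a; b; a]; [:: a; b; b]; [:: b; a; a];
     [:: b; a; b]; [:: b; b; b]; [:: a; a; a; b]; [:: a; a; b; a];
     [:: a; a; b; b]; [:: a; b; a; a]; [:: a; b; a; b]; [:: b; a; a; a];
     [:: b; a; b; a]; [:: b; a; b; b]; [:: a; a; a; b; a];
     [:: a; a; a; b; b]; [:: a; a; b; a; a]; [:: a; b; a; a; a];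
     [:: b; a; a; a; b]; [:: b; a; b; a; a]; [:: a; a; a; b; a; a];
     [:: a; a; b; a; a; a]; [:: b; a; a; a; b; a]; [:: b; a; a; a; b; b];
     [:: b; a; b; a; a; a]; [:: a; a; a; b; a; a; a];
     [:: b; a; a; a; b; a; a]; [:: b; a; a; a; b; a; a; a]].

Definition step (i : nat) (c : letter) : nat :=
  let p := nth (0, 0) cayley i in if c is La then p.1 else p.2.

Definition state (w : word) : nat := foldl step 0 w.

Definition normal_form (i : nat) : word := nth [::] normal_forms i.

Lemma all_states (p : pred nat) :
  all p (iota 0 36) -> forall i, i < 36 -> p i.
Proof. by move=> /allP p_ i i36; apply: p_; rewrite mem_iota. Qed.

Definition on_edges (p : nat -> letter -> bool) : bool :=
  all (fun i => p i La && p i Lb) (iota 0 36).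

Lemma all_edges p : on_edges p -> forall i c, i < 36 -> p i c.
Proof. by move=> p_ i c /(all_states p_) /andP[]; case: c. Qed.

(** The strict lower bound says that no edge returns to state 0; hence only the empty word has state
    0. *)
Lemma step_lt i c : i < 36 -> 0 < step i c < 36.
Proof. by move: i c; apply: all_edges; vm_compute. Qed.

Lemma foldl_step_lt i w : i < 36 -> foldl step i w < 36.
Proof.
by elim: w i => //= c w IHw i /(step_lt c) /andP[_]; apply: IHw.
Qed.

Lemma state_lt w : state w < 36.
Proof. exact: foldl_step_lt. Qed.

Lemma state_eq0 w : (state w == 0) = nilp w.
Proof.
case/lastP: w => // w c; rewrite /state foldl_rcons /nilp size_rcons.
by case/andP: (step_lt c (state_lt w)); case: step.
Qed.

Lemma state_normal_form i : i < 36 -> state (normal_form i) = i.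
Proof.
move=> i36; apply/eqP; move: i i36.
by apply: all_states; vm_compute.
Qed.

Lemma state_rcons w c : state (rcons w c) = step (state w) c.
Proof. exact: foldl_rcons. Qed.

(** Makes [state] multiplicative: the way [v] acts on the graph depends only on the state of [v]. *)
Lemma state_catE u v :
  state (u ++ v) = foldl step (state u) (normal_form (state v)).
Proof.
have -> : state (u ++ v) = foldl step (state u) v by exact: foldl_cat.
elim/last_ind: v => [//|v c IHv].
rewrite foldl_rcons IHv state_rcons -foldl_rcons; apply/eqP.
(* Appending [d] to a normal form and then normalizing leaves the action on all 36 states unchanged;
   this is a finite check. *)
suff /(_ _ c (state_lt v))/all_states/(_ _ (state_lt u)) :
    forall y d, y < 36 -> all (fun x =>
      foldl step x (rcons (normal_form y) d) ==
      foldl step x (normal_form (step y d))) (iota 0 36) by [].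
by apply: all_edges; vm_compute.
Qed.

(* These few contexts (x, y) suffice to link every product of a normal form and
   a letter to its own normal form. *)
Definition relation_step (u v : word) : bool :=
  has (fun x => has (fun y =>
      (transf_word u == transf_word (x ++ [:: a; b; a; a; a; b] ++ y)) &&
      (transf_word v == transf_word (x ++ [:: a; b] ++ y)))
    [:: [::]; [:: a; a; a]])
  [:: [::]; [:: a]; [:: b]; [:: a; a]; [:: a; b]; [:: b; a; a]].

Lemma h_relation : h [:: a; b; a; a; a; b] = h [:: a; b].
Proof.
apply/esym/eqmodP => /=; apply/asboolP => R _; exact.
Qed.

Lemma h_h0 u v : transf_word u == transf_word v -> h u = h v.
Proof. by move/h0_eqP => uv; rewrite /h uv. Qed.

Lemma h_relation_step u v : relation_step u v -> h u = h v.
Proof.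
move=> /(has_nthP [::])[i _ /(has_nthP [::])[j _ /andP[/h_h0-> /h_h0->]]].
by rewrite !h_cat h_relation.
Qed.

(** Soundness of the graph: along each edge, the extended normal form and the target normal form
    agree either already in [M0] or after one use of the defining relation. *)
Lemma h_normal_form w : h w = h (normal_form (state w)).
Proof.
elim/last_ind: w => [//|w c IHw].
rewrite state_rcons -cats1 h_cat IHw -h_cat cats1.
suff /(_ _ c (state_lt w))/orP[/h_h0|/h_relation_step] : forall i d, i < 36 ->
    (transf_word (rcons (normal_form i) d) ==
     transf_word (normal_form (step i d))) ||
    relation_step (rcons (normal_form i) d) (normal_form (step i d)) by [].
by apply: all_edges; vm_compute.
Qed.

(** Pairs of a transformation and a state produced by a common word. That twelve rounds reach a set
    closed under both letters is checked in [reachable_word]. *)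
Definition reachable : seq (seq nat * nat) :=
  iter 12 (fun s => undup (s ++
      [seq (map (act^~ c) p.1, step p.2 c) | p <- s, c <- [:: a; b]]))
    [:: (transf_word [::], state [::])].

Lemma reachable_word w : (transf_word w, state w) \in reachable.
Proof.
elim/last_ind: w => [|w c IHw]; first by vm_compute.
have -> : transf_word (rcons w c) = map (act^~ c) (transf_word w).
  by rewrite -map_comp; apply/eq_map => x /=; rewrite foldl_rcons.
rewrite state_rcons.
have : all (fun p => ((map (act^~ La) p.1, step p.2 La) \in reachable) &&
  ((map (act^~ Lb) p.1, step p.2 Lb) \in reachable)) reachable.
  by vm_compute.
by move=> /allP/(_ _ IHw)/andP[]; case: c.
Qed.

(** In [reachable] the first component determines the second, so the state factors through [M0]. *)
Lemma state_h0 u v : h0 u = h0 v -> state u = state v.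
Proof.
move=> /h0_eqP/eqP uv.
have : all (fun p => all (fun q => (p.1 == q.1) ==> (p.2 == q.2)) reachable)
    reachable.
  by vm_compute.
move=> /allP/(_ _ (reachable_word u))/allP/(_ _ (reachable_word v)).
by rewrite /= uv eqxx => /eqP.
Qed.

Definition h0_word (x : M0) : word := projT1 (cid (h0_surj x)).

Lemma h0_wordK x : h0 (h0_word x) = x.
Proof. by rewrite /h0_word; case: cid. Qed.

(** Completeness of the graph: equality of states is a congruence on [M0] identifying [ab] with
    [abaaab], so it contains the least such congruence. *)
Lemma state_h u v : h u = h v -> state u = state v.
Proof.
move=> /eqmodP /= /asboolP uv.
pose R : rel M0 := fun x y => state (h0_word x) == state (h0_word y).
(* The representative picked by [h0_word] is arbitrary, but its state is not. *)
have stateK w : state (h0_word (h0 w)) = state w.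
  by apply/state_h0/h0_wordK.
have state_mul x y : state (h0_word (x * y)%g) =
    foldl step (state (h0_word x)) (normal_form (state (h0_word y))).
  by rewrite -state_catE -[RHS]stateK h0_cat !h0_wordK.
have /eqP : R (h0 u) (h0 v); last by rewrite !stateK.
apply: uv; last by rewrite /R !stateK.
split=> [x y z|x x' y y' /eqP xx' /eqP yy'].
  by rewrite /R; split=> // /eqP->.
by rewrite /R !state_mul xx' yy'.
Qed.

Lemma h_eqE u v : h u = h v <-> state u = state v.
Proof.
split=> [/state_h//|uv].
by rewrite (h_normal_form u) (h_normal_form v) uv.
Qed.

(** * Relative classes *)

Definition cls (i : nat) : set word := [set w | state w = i].

Lemma cls_normal_form i : i < 36 -> cls i (normal_form i).
Proof. exact: state_normal_form. Qed.

Lemma cls_inj i j : i < 36 -> cls i = cls j -> i = j.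
Proof.
move=> i36 ij; have := cls_normal_form i36.
by rewrite ij /cls /= state_normal_form.
Qed.

Lemma state0_nil w : state w = 0 -> w = [::].
Proof. by move/eqP; rewrite state_eq0 => /nilP. Qed.

Lemma cls0 : cls 0 = [set [::]].
Proof. by apply/seteqP; split=> [w /state0_nil|w ->]. Qed.

Lemma contexts_nonempty w : w <> [::] -> contexts nonempty_words w = setT.
Proof.
move=> w0; apply/seteqP; split=> // -[u v] _ /= /(congr1 size).
by rewrite !size_cat; case: w w0 => //= c w _; rewrite addnS.
Qed.

(** All nonempty words have the same contexts, and the empty word is alone in its state, so the
    syntactic condition adds nothing to equality under [h]. *)
Lemma thetaE u v : theta nonempty_words h u v <-> state u = state v.
Proof.
split=> [[_ /h_eqE]//|uv]; split; last exact/h_eqE.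
rewrite /syn_equiv; have [u0|/eqP u0] := eqVneq (state u) 0.
  by rewrite (state0_nil u0) (state0_nil (esym (etrans (esym u0) uv))).
by rewrite !contexts_nonempty // => w0; apply: u0; rewrite 1?w0 // uv w0.
Qed.

Lemma rel_class_ofE w : rel_class_of nonempty_words h w = cls (state w).
Proof.
by apply/seteqP; split=> v; [move=> /thetaE | move=> vw; apply/thetaE].
Qed.

Lemma unit_classE : unit_class nonempty_words h = cls 0.
Proof. exact: rel_class_ofE. Qed.

Lemma rel_classP X :
  rel_class nonempty_words h X <-> exists2 i, i < 36 & X = cls i.
Proof.
split=> [[w ->]|[i i36 ->]].
  by exists (state w); [exact: state_lt | exact: rel_class_ofE].
by exists (normal_form i); rewrite rel_class_ofE state_normal_form.
Qed.

Lemma live_nonunitP X : live_nonunit_class nonempty_words h X <->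
  exists2 i, 0 < i < 36 & X = cls i.
Proof.
split=> [[/rel_classP[i i36 ->] _]|[i /andP[i0 i36] ->]].
  rewrite unit_classE => i0; exists i => //; rewrite i36 andbT lt0n.
  by apply/eqP => i_0; apply: i0; rewrite i_0.
split; first by apply/rel_classP; exists i.
  by move=> w _; exists ([:: a], [::]).
by rewrite unit_classE => /(cls_inj i36) i_0; rewrite i_0 in i0.
Qed.

Lemma lang_mulA : associative (@lang_mul letter).
Proof.
move=> X Y Z; apply/seteqP; split=> w.
  move=> [x Xx [_ [y Yy [z Zz <-]] <-]]; exists (x ++ y).
    by exists x => //; exists y.
  by exists z => //; rewrite catA.
move=> [_ [x Xx [y Yy <-]] [z Zz <-]]; exists x => //; exists (y ++ z).
  by exists y => //; exists z.
by rewrite catA.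
Qed.

Lemma lang_mul1 : left_id [set [::]] (@lang_mul letter).
Proof.
move=> X; apply/seteqP; split=> w; first by move=> [_ -> [x Xx <-]].
by move=> Xw; exists [::] => //; exists w.
Qed.

Lemma lang_mulr1 : right_id [set [::]] (@lang_mul letter).
Proof.
move=> X; apply/seteqP; split=> w.
  by move=> [x Xx [_ -> <-]]; rewrite cats0.
by move=> Xw; exists w => //; exists [::] => //; rewrite cats0.
Qed.

Definition cls_prod (ps : seq nat) : set word :=
  foldr (@lang_mul letter) [set [::]] (map cls ps).

Lemma cls_prod1 i : cls_prod [:: i] = cls i.
Proof. exact: lang_mulr1. Qed.

Lemma cls_prod_cat ps qs :
  cls_prod (ps ++ qs) = lang_mul (cls_prod ps) (cls_prod qs).
Proof.
elim: ps => [|p ps IHps]; first by rewrite lang_mul1.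
by rewrite -lang_mulA -IHps.
Qed.

(** * Splitting off the first or the last letter *)

(** The candidates for the primes; [cls_primeE] confirms them. *)
Definition prime_states : seq nat :=
  [:: 1; 2; 4; 5; 9; 11; 12; 14; 17; 18; 19; 20; 22; 27; 28].

(** The edge from [x] labelled [c] is the only one into [i]. Comparing states of one-letter words
    decides equality of letters. *)
Definition last_letter_split i x c : bool :=
  (step x c == i) && on_edges (fun z d =>
    (step z d == i) ==> (z == x) && (state [:: d] == state [:: c])).

Definition first_letter_split i c x : bool :=
  (foldl step (state [:: c]) (normal_form x) == i) && on_edges (fun z d =>
    (foldl step (state [:: d]) (normal_form z) == i) ==>
    (z == x) && (state [:: d] == state [:: c])).

(** Uniqueness of the incoming edge lets every word of the class shed its last letter; the reverse
    inclusion is multiplicativity of [state]. *)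
Lemma last_letter_splitP i x c : 0 < i -> last_letter_split i x c ->
  cls i = lang_mul (cls x) (cls (state [:: c])).
Proof.
move=> i0 /andP[/eqP xci /all_edges only_x]; apply/seteqP; split=> w.
  case/lastP: w => [w0|w d]; first by rewrite -w0 in i0.
  move=> wi; have := only_x _ d (state_lt w).
  rewrite -state_rcons wi eqxx => /andP[/eqP wx /eqP dc].
  by exists w => //; exists [:: d] => //; rewrite cats1.
move=> [u ux [v vc <-]]; rewrite /cls /= state_catE ux vc.
by rewrite -xci; case: (c).
Qed.

Lemma first_letter_splitP i c x : 0 < i -> first_letter_split i c x ->
  cls i = lang_mul (cls (state [:: c])) (cls x).
Proof.
move=> i0 /andP[/eqP cxi /all_edges only_x]; apply/seteqP; split=> w.
  case: w => [w0|d w wi]; first by rewrite -w0 in i0.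
  have := only_x _ d (state_lt w).
  rewrite -state_catE wi eqxx => /andP[/eqP wx /eqP dc].
  by exists [:: d] => //; exists w.
by move=> [u uc [v vx <-]]; rewrite /cls /= state_catE uc vx.
Qed.

(** The shorter normal forms of [x] and [y] are the measure for the induction in
    [factorization_exists]. *)
Lemma split_class i : 0 < i < 36 -> i \notin prime_states ->
  exists x y, [/\ 0 < x < 36, 0 < y < 36, cls i = lang_mul (cls x) (cls y),
    size (normal_form x) < size (normal_form i) &
    size (normal_form y) < size (normal_form i)].
Proof.
move=> /andP[i0 i36] iNp.
have : forall i, i < 36 -> [|| i == 0, i \in prime_states |
  (1 < size (normal_form i)) && has (fun x =>
    (size (normal_form x) < size (normal_form i)) &&
    [|| last_letter_split i x La, last_letter_split i x Lb,
        first_letter_split i La x | first_letter_split i Lb x])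
  (iota 1 35)].
  by apply: all_states; vm_compute.
move=> /(_ i i36); rewrite (negPf iNp) -[i == 0]negbK -lt0n i0.
move=> /andP[i1 /hasP[x]]; rewrite mem_iota => /andP[x0 x36] /andP[xi].
have letter c : 0 < state [:: c] < 36 /\
    size (normal_form (state [:: c])) < size (normal_form i).
  by case: c.
have x_bound : 0 < x < 36 by rewrite x0.
by case/or4P => [/(last_letter_splitP i0)|/(last_letter_splitP i0)
  |/(first_letter_splitP i0)|/(first_letter_splitP i0)] ->;
  [exists x, (state [:: a]) | exists x, (state [:: b])
  |exists (state [:: a]), x | exists (state [:: b]), x];
  split=> //; apply letter.
Qed.

Lemma factorization_exists i : 0 < i < 36 ->
  exists2 ps, ps <> [::] & all (mem prime_states) ps /\ cls i = cls_prod ps.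
Proof.
have [n] := ubnP (size (normal_form i)); elim: n i => // n IHn i /ltnSE i_n i36.
have [ip|iNp] := boolP (i \in prime_states).
  by exists [:: i]; rewrite //= cls_prod1 ip.
have [x [y [x36 y36 -> xi yi]]] := split_class i36 iNp.
have [ps ps0 [pps ->]] := IHn x (leq_trans xi i_n) x36.
have [qs _ [pqs ->]] := IHn y (leq_trans yi i_n) y36.
exists (ps ++ qs); first by case: (ps) ps0.
by rewrite all_cat pps pqs cls_prod_cat.
Qed.

(** * Factorizations of single words *)

(* [parses_from i w] lists the values of all cuttings of [u ++ w] into nonempty
   factors, the first of which extends [u], where [state u = i]. *)
Fixpoint parses_from (i : nat) (w : word) : seq (seq nat) :=
  if w is c :: w' then
    parses_from (step i c) w' ++ [seq i :: ps | ps <- parses_from (step 0 c) w']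
  else [:: [:: i]].

Definition parses (w : word) : seq (seq nat) :=
  if w is c :: w' then parses_from (step 0 c) w' else [:: [::]].

Lemma parses_from_cat i u w ps :
  ps \in parses w -> foldl step i u :: ps \in parses_from i (u ++ w).
Proof.
elim: u i => [|c u IHu] i psw /=; last by rewrite mem_cat IHu.
case: w psw => [|c w psw] /=; first by move=> /[!inE] /eqP->.
by rewrite mem_cat map_f ?orbT.
Qed.

(** Membership in the product cuts [w] into factors with states [ps]; without 0 in [ps], all factors
    are nonempty, as the enumeration requires. *)
Lemma parses_cls_prod w ps : 0 \notin ps -> cls_prod ps w -> ps \in parses w.
Proof.
elim: ps w => [w _ ->//|p ps IHps w].
rewrite inE negb_or => /andP[p0 ps0] [u up [v /(IHps _ ps0) psv <-]].
case: u up p0 => [<-//|c u <- _].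
exact: parses_from_cat.
Qed.

(* Found by search, so that [common_parses] has one element for each class. *)
Definition test_words : seq (seq word) :=
  [:: [::]; [::]; [::]; [::]; [:: [:: a; b; a; a; b]];
     [:: [:: b; b; a; a; a]]; [::]; [::]; [:: [:: a; a; b; a; a; b]];
     [:: [:: a; b; a; a; b; b; a; a; a]]; [:: [:: a; b; a; a; b; b]];
     [:: [:: b; b; a]]; [:: [:: b; b; a; a; a; b; a; a; b]]; [::];
     [:: [:: b; a; a; b]]; [:: [:: a; a; b; a; a; b; b; a; a; a]];
     [:: [:: a; a; b; a; a; b; b]]; [:: [:: a; b; b; b]];
     [:: [:: a; a; b; a; b]]; [:: [:: b; b; b; a]];
     [:: [:: b; a; b; a; a; b; b; a; a; a]; [:: b; b; a; a; a; b; a]];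
     [:: [:: b; b; a; a; a; b; a; a; b; b]];
     [:: [:: b; a; a; b; b; a; a; a]]; [:: [:: b; a; a; b; b]];
     [:: [:: a; a; b; b; b]]; [:: [:: a; b; a; a; b; b; a; a]];
     [:: [:: b; b; b; a; b; a; a; b]]; [:: [:: b; b; a; a; a; b; b; b]];
     [:: [:: b; a; a; b; b; a]]; [:: [:: a; a; b; a; a; b; b; a; a]];
     [:: [:: b; b; b; a; b; a; a; b; a]; [:: b; a; a; a; b; b; a; a; a]];
     [:: [:: b; b; b; a; b; a; a; b; b]];
     [:: [:: b; a; b; a; a; b; b; a; a]; [:: b; b; a; a; a; b; a; a; a]];
     [:: [:: b; a; a; b; b; a; a]]; [:: [:: b; b; b; a; b; b; b]];
     [:: [:: b; b; b; a; b; a; a; b; b; a; a]]].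

(** For a prime candidate all cuttings compete, since primality must exclude every product of
    non-unit classes; for the other states only cuttings into prime candidates do. *)
Definition common_parses (i : nat) : seq (seq nat) :=
  [seq ps <- parses (normal_form i) |
    ((i \in prime_states) || all (mem prime_states) ps) &&
    all (fun w => ps \in parses w) (nth [::] test_words i)].

Lemma common_parse_unique i ps qs : i < 36 ->
  ps \in common_parses i -> qs \in common_parses i -> ps = qs.
Proof.
move=> i36; have : forall j, j < 36 -> size (common_parses j) <= 1.
  by apply: all_states; vm_compute.
move=> /(_ i i36).
by case: common_parses => [|rs [|]]//= _; rewrite !inE => /eqP-> /eqP->.
Qed.

(** Equality of sets forces [ps] to parse every word of the class, in particular its normal form and
    its test words. *)
Lemma cls_prod_common_parse i ps : i < 36 -> 0 \notin ps ->
  (i \in prime_states) || all (mem prime_states) ps ->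
  cls i = cls_prod ps -> ps \in common_parses i.
Proof.
move=> i36 ps0 ip ips; rewrite mem_filter ip /= andbC.
rewrite parses_cls_prod -?ips //=; last exact: cls_normal_form.
have : forall j, j < 36 -> all (fun w => state w == j) (nth [::] test_words j).
  by apply: all_states; vm_compute.
move=> /(_ i i36).
by apply: sub_all => w /eqP wi; rewrite parses_cls_prod -?ips.
Qed.

(** * Relative primes *)

Lemma prime_states_bound i : i \in prime_states -> 0 < i < 36.
Proof. by move: i; apply/allP; vm_compute. Qed.

Lemma cls_primeE i : 0 < i < 36 ->
  rel_prime nonempty_words h (cls i) <-> i \in prime_states.
Proof.
move=> i_bound; have /andP[i0 i36] := i_bound.
split=> [[_ prime_i]|ip]; last first.
  split; first by apply/live_nonunitP; exists i.
  move=> _ _ /rel_classP[x x36 ->] /rel_classP[y y36 ->] ixy.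
  rewrite unit_classE; have [->|x0] := eqVneq x 0; first by left.
  have [->|y0] := eqVneq y 0; first by right.
  (* The class itself and a product of two non-unit classes would both be common parses, yet their
     lengths differ. *)
  suff : [:: x; y] = [:: i] by [].
  apply: (@common_parse_unique i) => //; apply: cls_prod_common_parse => //.
  - by rewrite !inE !(eq_sym 0) negb_or x0.
  - by rewrite ip.
  - by rewrite ixy -[in RHS]cat1s cls_prod_cat !cls_prod1.
  - by rewrite inE eq_sym -lt0n.
  - by rewrite ip.
  - by rewrite cls_prod1.
apply: contrapT => /negP/(split_class i_bound).
move=> [x [y [/andP[x0 x36] /andP[y0 y36] ixy _ _]]].
have := prime_i _ _ _ _ ixy; rewrite unit_classE.
by case=> [||/(cls_inj x36)|/(cls_inj y36)];
  [apply/rel_classP; exists x | apply/rel_classP; exists y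
  | move=> xE; rewrite xE in x0 | move=> yE; rewrite yE in y0].
Qed.

Lemma rel_primeP P :
  rel_prime nonempty_words h P <-> exists2 i, i \in prime_states & P = cls i.
Proof.
split=> [Pp|[i ip ->]]; last first.
  by apply/cls_primeE; first exact: prime_states_bound.
have [/live_nonunitP[i i36 PE] _] := Pp.
by exists i => //; apply/cls_primeE; rewrite -?PE.
Qed.

Lemma rel_primes_cls (Ps : seq (set word)) :
  {in Ps, forall P, rel_prime nonempty_words h P} ->
  exists2 ps, all (mem prime_states) ps & Ps = map cls ps.
Proof.
elim: Ps => [|P Ps IHPs] PsP; first by exists [::].
have [|ps psp ->] := IHPs.
  by move=> Q QPs; apply: PsP; rewrite inE QPs orbT.
have /rel_primeP[p pp ->] := PsP P (mem_head _ _).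
by exists (p :: ps); rewrite //= pp.
Qed.

Theorem theorem12p1 :
  [/\ unit_separated nonempty_words h,
      substitutable nonempty_words h,
      [set P | rel_prime nonempty_words h P] #= `I_15,
      [set X | live_nonunit_class nonempty_words h X] #= `I_35 &
      forall X, live_nonunit_class nonempty_words h X ->
        exists! Ps, exact_factorization nonempty_words h X Ps].
Proof.
split.
- by rewrite /unit_separated unit_classE cls0.
- by move=> x y xy _; have /thetaE[] := iffLR (h_eqE x y) xy.
- have -> : [set P | rel_prime nonempty_words h P] =
      (fun k => cls (nth 0 prime_states k)) @` `I_15.
    apply/seteqP; split=> [P /rel_primeP[i ip ->]|_ [k k15 <-]].
      by exists (index i prime_states);
        [rewrite -index_mem in ip | rewrite nth_index].
    by apply/rel_primeP; exists (nth 0 prime_states k); rewrite ?mem_nth.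
  apply: inj_card_eq => j k; rewrite !inE => j15 k15 /cls_inj jk.
  apply/eqP; rewrite -(nth_uniq 0 (s := prime_states)) //; apply/eqP/jk.
  by have /prime_states_bound/andP[] := mem_nth 0 (j15 : j < size prime_states).
- have -> : [set X | live_nonunit_class nonempty_words h X] =
      (* The shift skips state 0, the unit class. *)
      (fun k => cls k.+1) @` `I_35.
    apply/seteqP; split=> [X /live_nonunitP[[|i] // i36 ->]|_ [k k35 <-]].
      by exists i.
    by apply/live_nonunitP; exists k.+1.
  apply: inj_card_eq => j k; rewrite !inE => j35 k35.
  by move=> /(cls_inj (i := j.+1) j35)[].
- move=> X /live_nonunitP[i i_bound ->]; have /andP[_ i36] := i_bound.
  have common ps : all (mem prime_states) ps -> cls i = cls_prod ps ->
      ps \in common_parses i.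
    move=> psp; apply: cls_prod_common_parse; rewrite ?psp ?orbT //.
    (* State 0 is not in [prime_states]. *)
    by apply/negP => /(allP psp).
  have [ps ps0 [psp ips]] := factorization_exists i_bound.
  exists (map cls ps); split.
    split=> //; first by case: (ps) ps0.
    move=> P /mapP[p pps ->]; apply/rel_primeP; exists p => //.
    exact: (allP psp).
  move=> Qs [_ /rel_primes_cls[qs qsp ->] iqs]; congr (map cls _).
  by apply: common_parse_unique; [exact: i36 | exact: common..].
Qed.
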